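(* Consider the disordered monomer-dimer model on a finite graph $G$ with maximum degree $D$. There exist constants $c,C>0$ depending only on $D$ and the weight distributions (and not otherwise on $G$) such that for any edges $e,e'\in E(G)$, $$\mathbf{E}\left|\langle\mathbf{1}_{\{e\in\mathsf{M}_G,\,e'\in\mathsf{M}_G\}}\rangle-\langle\mathbf{1}_{\{e\in\mathsf{M}_G\}}\rangle\langle\mathbf{1}_{\{e'\in\mathsf{M}_G\}}\rangle\right|\le Ce^{-c\,\mathrm{dist}(e,e')}.$$
   Context: Let $G=(V(G),E(G))$ be a finite graph. A (partial) matching of $G$ is a set of edges of $G$ no two of which share a vertex; $\mathcal{M}_G$ is the set of all matchings of $G$ (including the empty one). For $x\in V(G)$ and $M\in\mathcal{M}_G$, $x\notin M$ means that $x$ is not an endpoint of any edge of $M$ (it is unmatched). The edges carry i.i.d. real weights $(w_e)_{e\in E(G)}$ and the vertices carry i.i.d. real weights $(\nu_x)_{x\in V(G)}$; the edge weights are independent of the vertex weights, and the two distributions may differ. The disordered monomer-dimer model on $G$ (with inverse temperature normalized to $1$, absorbed in the weights) is the random Gibbs measure $\mu_G(M)=Z_G^{-1}\exp(\sum_{e\in M}w_e+\sum_{x\notin M}\nu_x)$, $M\in\mathcal{M}_G$, where $Z_G$ is the normalizing constant. $\mathsf{M}_G$ denotes a random matching sampled from $\mu_G$ given the weights, and $\langle\cdot\rangle$ the Gibbs expectation with respect to $\mu_G$ (for fixed weights). $\mathbf{E}$ refers to the randomness of the weights. $\mathrm{dist}(e,e')$ is the graph distance in $G$ between the edges, i.e.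 the minimum graph distance between an endpoint of $e$ and an endpoint of $e'$ (it is $+\infty$, with $e^{-\infty}=0$, if they lie in different components). *)

(* Defs.v *)
From HB Require Import structures.
From mathcomp Require Import all_boot all_order all_algebra.

Set Implicit Arguments.
Unset Strict Implicit.
Unset Printing Implicit Defensive.

(* The finite set notations below are used before the Require of classical sets,
   which rebinds [set x | P]. *)

Definition edge_set (V : finType) (adj : rel V) : {set {set V}} :=
  [set [set p.1; p.2] | p : V * V & adj p.1 p.2].

Definition edge (V : finType) (adj : rel V) : finType :=
  {f : {set V} | f \in edge_set adj}.

Definition neighbours (V : finType) (adj : rel V) (x : V) : {set V} :=
  [set y | adj x y].

Definition max_degree (V : finType) (adj : rel V) : nat :=
  \max_(x : V) #|neighbours adj x|.

Definition matching (V : finType) (adj : rel V) (M : {set edge adj}) : bool :=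
  [forall e in M, forall f in M, (e != f) ==> [disjoint val e & val f]].

Definition unmatched (V : finType) (adj : rel V) (M : {set edge adj}) (x : V) :
    bool :=
  [forall e in M, x \notin val e].

From mathcomp Require Import all_classical all_reals all_analysis.
Import Order.TTheory GRing.Theory Num.Theory.
Import numFieldNormedType.Exports.

Local Open Scope classical_set_scope.
Local Open Scope ring_scope.
Local Open Scope ereal_scope.

(* The infimum of the empty set is +oo, hence so is the distance between
   different components. *)
Definition vertex_dist (R : realType) (V : finType) (adj : rel V) (x y : V) :
    \bar R :=
  ereal_inf [set ((size p)%:R : R)%:E | p in
              [set p : seq V | path adj x p /\ last x p = y]].

Definition edge_dist (R : realType) (V : finType) (adj : rel V)
    (e e' : edge adj) : \bar R :=
  ereal_inf [set vertex_dist R adj p.1 p.2 | p in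
              [set p : V * V | p.1 \in val e /\ p.2 \in val e']].

Section Gibbs.
Local Open Scope ring_scope.
Context (R : realType) (V : finType) (adj : rel V).
Variables (w : edge adj -> R) (nu : V -> R).

Definition boltzmann (M : {set edge adj}) : R :=
  expR (\sum_(e in M) w e + \sum_(x | unmatched M x) nu x).

Definition partition_function : R :=
  \sum_(M : {set edge adj} | matching M) boltzmann M.

Definition gibbs (M : {set edge adj}) : R := boltzmann M / partition_function.

Definition gibbs_mean (f : {set edge adj} -> R) : R :=
  \sum_(M : {set edge adj} | matching M) f M * gibbs M.

Definition edge_covariance (e e' : edge adj) : R :=
  gibbs_mean (fun M => ((e \in M) && (e' \in M))%:R)
  - gibbs_mean (fun M => (e \in M)%:R) * gibbs_mean (fun M => (e' \in M)%:R).

End Gibbs.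

Section Independence.
Context (d : measure_display) (T : measurableType d) (R : realType)
  (P : probability T R).

Definition mutually_independent (I : finType) (X : I -> {RV P >-> R}) : Prop :=
  forall (J : {set I}) (B : I -> set R),
    (forall i, i \in J -> measurable (B i)) ->
    P (\bigcap_(i in [set` J]) (X i @^-1` B i)) =
    \prod_(i in J) P (X i @^-1` B i).

Definition iid_with_law (I : finType) (mu : probability R R)
    (X : I -> {RV P >-> R}) : Prop :=
  mutually_independent X /\
  forall (i : I) (B : set R), measurable B -> distribution P (X i) B = mu B.

Definition sigma_family (I : Type) (X : I -> {RV P >-> R}) : set (set T) :=
  <<s \bigcup_(i in [set: I]) preimage_set_system [set: T] (X i) measurable >>.

Definition independent_families (I J : Type) (X : I -> {RV P >-> R})
    (Y : J -> {RV P >-> R}) : Prop :=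
  forall A B : set T, sigma_family X A -> sigma_family Y B ->
    P (A `&` B) = P A * P B.

End Independence.

(* Main.v *)
Require Import Defs.
From mathcomp Require Import all_boot all_order all_algebra.
From mathcomp Require Import zify ring lra.

(** Why correlations decay.  Fix the weights and let [Q S] be the probability
    that the edge [e'] is used once the vertices of [S] have been deleted.
    Conditioning on what happens at a vertex [x] outside [S] and [e'] gives
      Q S - Q (S + x) = sum over edges f = xy of
                          P(f matched in G - S) * (Q (S + x + y) - Q (S + x)),
    because on the event that [x] is unmatched the two sides agree.  So the
    influence of deleting [x] is at most P(x matched in G - S) times the largest
    influence of deleting a neighbour [y] in [G - S - x] ([influence_step]), and
    iterating runs along self-avoiding walks until they can reach [e']
    ([influence_decay]).  The covariance of [e] and [e'] is P(e) times the
    effect on [Q] of deleting the two endpoints of [e], hence is bounded by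
    twice the largest product of matching probabilities along a self-avoiding
    walk that starts at [e] ([activity_covariance_decay]).

    Matching probabilities need not be uniformly below [1], since the weights
    are unbounded.  But removing an edge [xy] from a matching compares
    P(xy matched) with P(x unmatched) at the price
    exp (w_xy - nu_x - nu_y), so P(x matched) <= theta < 1 in every [G - S]
    ([p_matched_le]) as soon as no site of the star of [x] is bad: no incident
    edge weight exceeds [K], and no vertex weight at [x] or at a neighbour is
    below [-K].  A bad site spoils at most [D + 2] vertices, so a self-avoiding
    walk of [2 (D + 2) k] vertices whose stars contain at most [k] bad sites has
    at least [(D + 2) k >= k] unspoiled vertices ([count_clean]) and contributes
    at most [theta ^ k].

    It remains to bound the probability that some walk of that length meets more
    bad sites ([prob_bad_event]).  There are exponentially many walks and,
    along each, exponentially many sets of [k] sites; by independence a given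
    set is entirely bad with probability at most [eps ^ k], where
    [eps -> 0] as [K -> +oo].  Choosing [K] large beats the entropy. *)

Set Implicit Arguments.
Unset Strict Implicit.
Unset Printing Implicit Defensive.
Import Order.TTheory GRing.Theory Num.Theory.
Local Open Scope ring_scope.

(** * Finite sets *)

Lemma disjoint_setUr (T : finType) (A B C : {set T}) :
  [disjoint A & B :|: C] = [disjoint A & B] && [disjoint A & C].
Proof. by rewrite -!setI_eq0 setIUr setU_eq0. Qed.

Lemma disjoint_set1r (T : finType) (A : {set T}) (x : T) :
  [disjoint A & [set x]] = (x \notin A).
Proof. by rewrite disjoint_sym disjoints1. Qed.

Lemma card_sum_parts (A B : finType) (J : {set A + B}) :
  #|J| = (#|inl @^-1: J| + #|inr @^-1: J|)%N.
Proof.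
rewrite -!sum1_card big_sumType /=.
by congr (_ + _)%N; apply: eq_bigl => z; rewrite !inE.
Qed.

Lemma exists_subset_card (T : finType) (A : {set T}) k : (k <= #|A|)%N ->
  exists2 J : {set T}, J \subset A & #|J| == k.
Proof.
rewrite -bin_gt0 -cards_draws card_gt0 => /set0Pn[J].
by rewrite inE => /andP[]; exists J.
Qed.

Lemma count_subsets (T : finType) (A : {set T}) (p : pred {set T}) :
  (forall J, p J -> J \subset A) -> (count p (index_enum _) <= 2 ^ #|A|)%N.
Proof.
move=> pA; rewrite -card_powerset -sum1_count -sum1_card.
rewrite [leqLHS]big_mkcond [leqRHS]big_mkcond; apply: leq_sum => J _ /=.
by case: ifP => // /pA JA; rewrite inE JA.
Qed.

(** * Edges, matchings and deletion of vertices *)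

Section Edges.
Variables (V : finType) (adj : rel V).
Hypotheses (adj_sym : symmetric adj) (adj_irr : irreflexive adj).
Implicit Types (f : edge adj) (x y : V) (M : {set edge adj}) (S : {set V}).

Lemma edge_endsP f x : x \in val f ->
  exists y, [/\ val f = [set x; y], adj x y & x != y].
Proof.
case: f => F /= /imsetP[[u v]]; rewrite inE /= => uv ->.
rewrite !inE => /orP[]/eqP->.
  by exists v; split => //; apply/eqP => E; rewrite E adj_irr in uv.
exists u; split; rewrite ?(setUC [set v]) // 1?adj_sym //.
by apply/eqP => E; rewrite E adj_irr in uv.
Qed.

Lemma edge_nonempty f : exists x, x \in val f.
Proof.
case: f => F /= /imsetP[[u v]] _ ->.
by exists u; rewrite !inE eqxx.
Qed.

Lemma card_edge f : #|val f| = 2.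
Proof.
have [x xf] := edge_nonempty f; have [y [-> _ xy]] := edge_endsP xf.
by rewrite cards2 xy.
Qed.

Lemma card_incident x : (#|[set f : edge adj | x \in val f]| <= #|neighbours adj x|)%N.
Proof.
rewrite -(card_imset _ val_inj).
apply: leq_trans (leq_imset_card (fun y => [set x; y]) _).
apply: subset_leq_card; apply/subsetP => F /imsetP[f xf ->]; rewrite inE in xf.
have [y [-> xy _]] := edge_endsP xf.
by apply/imsetP; exists y; rewrite ?inE.
Qed.

Lemma unmatchedPn M x :
  reflect (exists2 f, f \in M & x \in val f) (~~ unmatched M x).
Proof.
rewrite /unmatched negb_forall_in.
by apply: (iffP exists_inP) => -[f fM]; rewrite ?negbK => xf;
  exists f; rewrite ?negbK.
Qed.

Lemma matching_unique M x f f' : matching M -> f \in M -> f' \in M ->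
  x \in val f -> x \in val f' -> f = f'.
Proof.
move=> /forall_inP/(_ f) mM fM f'M xf xf'.
have /forall_inP/(_ _ f'M)/implyP := mM fM.
case: eqVneq => //= _ /(_ isT); rewrite disjoint_subset => /subsetP/(_ _ xf).
by rewrite inE xf'.
Qed.

(** Matchings of the graph with the vertices of [S] deleted are encoded as
    matchings of the whole graph that avoid [S], so that all deletions live in
    one type of edge sets. *)
Definition avoids (S : {set V}) M := [forall f in M, [disjoint val f & S]].

Lemma avoidsU S S' M : avoids (S :|: S') M = avoids S M && avoids S' M.
Proof.
apply/forall_inP/andP => [h | [/forall_inP h /forall_inP u] f fM].
  by split; apply/forall_inP => f /h; rewrite disjoint_setUr => /andP[].
by rewrite disjoint_setUr h ?u.
Qed.

Lemma avoids1 x M : avoids [set x] M = unmatched M x.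
Proof. by apply: eq_forallb => f; rewrite disjoint_set1r. Qed.

Lemma avoids_notin f S M : avoids (val f :|: S) M -> f \notin M.
Proof.
move=> /forall_inP h; apply/negP => /h; have [x xf] := edge_nonempty f.
rewrite disjoint_subset => /subsetP/(_ _ xf).
by rewrite inE inE xf.
Qed.

(** The bijection behind every recursion on matchings: those containing [f]
    correspond to those of the graph with both endpoints of [f] deleted. *)
Lemma matching_avoidsU1 f S M : [disjoint val f & S] -> f \notin M ->
  (matching (f |: M) && avoids S (f |: M))
  = (matching M && avoids (val f :|: S) M).
Proof.
move=> fS fM; rewrite avoidsU.
have -> : avoids S (f |: M) = avoids S M.
  apply/forall_inP/forall_inP => h g gM; first by apply: h; rewrite inE gM orbT.
  by move: gM; rewrite inE in_set1 => /orP[/eqP->|/h].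
rewrite andbA; congr (_ && _).
apply/idP/andP => [|[mM aM]]; last first.
  apply/forall_inP => g; rewrite inE in_set1 => gM.
  apply/forall_inP => h; rewrite inE in_set1 => hM; apply/implyP => gh.
  have := forall_inP aM; move=> aM'.
  case/predU1P: gM gh => [->|gM]; case/predU1P: hM => [->|hM] gh.
  - by rewrite eqxx in gh.
  - by rewrite disjoint_sym aM'.
  - exact: aM'.
  - by have /forall_inP/(_ _ hM)/implyP := forall_inP mM _ gM; apply.
move=> /forall_inP h; split; apply/forall_inP => g gM.
  apply/forall_inP => k kM.
  by have /forall_inP := h g (setU1r _ gM); apply; exact: setU1r.
have /forall_inP/(_ f (setU11 _ _))/implyP := h g (setU1r _ gM); apply.
by apply: contraNneq fM => <-.
Qed.

Lemma unmatchedU1 f M x :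
  unmatched (f |: M) x = (x \notin val f) && unmatched M x.
Proof.
apply/forall_inP/andP => [h | [xf /forall_inP h] g].
  split; first by apply: h; rewrite setU11.
  by apply/forall_inP => g gM; apply: h; rewrite setU1r.
by rewrite inE in_set1 => /predU1P[->//|/h].
Qed.

End Edges.

(** * Partition functions with deleted vertices *)

Section PartitionSums.
Variables (V : finType) (adj : rel V) (R : realFieldType).
Hypotheses (adj_sym : symmetric adj) (adj_irr : irreflexive adj).
Variables (a : edge adj -> R) (b : V -> R).
Hypotheses (a_gt0 : forall f, 0 < a f) (b_gt0 : forall x, 0 < b x).
Implicit Types (f : edge adj) (x y : V) (M : {set edge adj}) (S : {set V}).
Implicit Types (g : {set edge adj} -> R).

Definition weight S M : R :=
  (\prod_(f in M) a f) * \prod_(x | unmatched M x && (x \notin S)) b x.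

Definition psum S g : R :=
  \sum_(M | matching M && avoids S M) g M * weight S M.

Lemma weight_gt0 S M : 0 < weight S M.
Proof. by apply: mulr_gt0; apply: prodr_gt0. Qed.

Lemma psum_containing f S g : [disjoint val f & S] ->
  \sum_(M | (matching M && avoids S M) && (f \in M)) g M * weight S M
  = a f * psum (val f :|: S) (fun M => g (f |: M)).
Proof.
move=> fS; rewrite /psum mulr_sumr.
rewrite (reindex_onto (fun M => f |: M) (fun M => M :\ f)) /=; last first.
  by move=> M /andP[_ fM]; rewrite setD1K.
apply: eq_big => [M | M].
  have [fM|fM] := boolP (f \in M).
    transitivity false; last first.
      by apply/esym/negP => /andP[_ /avoids_notin/negP].
    by apply/negP => /andP[_ /eqP E]; rewrite -E !inE eqxx in fM.
  by rewrite matching_avoidsU1 // setU11 andbT setU1K // eqxx andbT.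
move=> /andP[_ /eqP E].
have fM : f \notin M by rewrite -E !inE eqxx.
rewrite /weight big_setU1 //= -!mulrA mulrCA; congr (_ * (_ * (_ * _))); apply: eq_bigl => x.
by rewrite unmatchedU1 !inE negb_or -andbA andbCA.
Qed.

Lemma psum_unmatched x S g : x \notin S ->
  \sum_(M | (matching M && avoids S M) && unmatched M x) g M * weight S M
  = b x * psum (x |: S) g.
Proof.
move=> xS; rewrite /psum mulr_sumr; apply: eq_big => [M|M /andP[_ uM]].
  by rewrite avoidsU avoids1 [unmatched M x && _]andbC andbA.
rewrite /weight [RHS]mulrCA; congr (_ * _); rewrite [RHS]mulrCA; congr (_ * _).
rewrite (bigD1 x) ?uM //=; congr (_ * _); apply: eq_bigl => y.
by rewrite !inE negb_or -andbA; congr (_ && _); rewrite andbC.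
Qed.

(** Split according to the partner of [x]: a matching leaves [x] free or uses
    exactly one of the edges at [x]. *)
Lemma psum_rec x S g : x \notin S ->
  psum S g = b x * psum (x |: S) g +
   \sum_(f : edge adj | (x \in val f) && [disjoint val f & S])
     a f * psum (val f :|: S) (fun M => g (f |: M)).
Proof.
move=> xS; rewrite /psum (bigID (fun M => unmatched M x)) psum_unmatched //=.
congr (_ + _).
rewrite (eq_bigr (fun M => \sum_(f : edge adj | (x \in val f) && (f \in M))
   g M * weight S M)); last first.
  move=> M /andP[/andP[mM aM] /unmatchedPn[f fM xf]].
  rewrite (big_pred1 f) // => f'; apply/andP/eqP => [[xf' f'M]|->//].
  exact: matching_unique mM f'M fM xf' xf.
rewrite (exchange_big_dep (fun f : edge adj => (x \in val f) && [disjoint val f & S])) /=.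
  apply: eq_bigr => f /andP[xf fS]; rewrite -psum_containing //.
  apply: eq_bigl => M; rewrite xf /=.
  have [fM|] := boolP (f \in M); rewrite ?andbF // !andbT.
  suff -> : ~~ unmatched M x by rewrite andbT.
  by apply/unmatchedPn; exists f.
move=> M f /andP[/andP[_ /forall_inP aM] _] /andP[-> fM].
exact: aM.
Qed.

Lemma psum_ge0 S g : (forall M, 0 <= g M) -> 0 <= psum S g.
Proof.
by move=> g0; apply: sumr_ge0 => M _; rewrite mulr_ge0 // ltW // weight_gt0.
Qed.

Lemma psum_mono S g h : (forall M, g M <= h M) -> psum S g <= psum S h.
Proof. by move=> gh; apply: ler_sum => M _; rewrite ler_pM2r ?weight_gt0. Qed.

Definition Z S := psum S (fun=> 1).

Lemma Z_gt0 S : 0 < Z S.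
Proof.
rewrite /Z /psum (bigD1 set0) /=; last first.
  by apply/andP; split; apply/forall_inP => f; rewrite inE.
rewrite ltr_pwDl ?mul1r ?weight_gt0 //.
by apply: sumr_ge0 => M _; rewrite mul1r ltW ?weight_gt0.
Qed.

(** Gibbs expectation in the graph with the vertices of [S] deleted; the
    activities [a] and [b] stand for the exponentials of the weights. *)
Definition mean S g := psum S g / Z S.

Lemma mean_itv S g : (forall M, 0 <= g M <= 1) -> 0 <= mean S g <= 1.
Proof.
move=> g01; rewrite /mean divr_ge0 ?(ltW (Z_gt0 S)) //=; last first.
  by apply: psum_ge0 => M; have /andP[] := g01 M.
rewrite ler_pdivrMr ?Z_gt0 // mul1r; apply: psum_mono => M.
by have /andP[] := g01 M.
Qed.

Lemma ler_dist01 (u v : R) : 0 <= u <= 1 -> 0 <= v <= 1 -> `|u - v| <= 1.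
Proof. by move=> /andP[? ?] /andP[? ?]; rewrite ler_norml; lra. Qed.

(** The probabilities, in the graph with [S] deleted, that [f] is matched and
    that [x] is free, written as ratios of partition functions. *)
Definition p_edge S f := a f * Z (val f :|: S) / Z S.
Definition p_free S x := b x * Z (x |: S) / Z S.

Lemma p_total x S : x \notin S ->
  p_free S x + \sum_(f : edge adj | (x \in val f) && [disjoint val f & S]) p_edge S f = 1.
Proof.
move=> xS; rewrite /p_free /p_edge -mulr_suml -mulrDl.
by rewrite {1}/Z -psum_rec // divff // gt_eqF // Z_gt0.
Qed.

Lemma mean_rec x S g : x \notin S ->
  (forall f M, x \in val f -> g (f |: M) = g M) ->
  mean S g = p_free S x * mean (x |: S) g +
   \sum_(f : edge adj | (x \in val f) && [disjoint val f & S])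
     p_edge S f * mean (val f :|: S) g.
Proof.
move=> xS gx; rewrite /mean {1}(psum_rec g xS) mulrDl mulr_suml.
have ZC S' c : c * Z S' / Z S * (psum S' g / Z S') = c * psum S' g / Z S.
  by field; rewrite !gt_eqF ?Z_gt0.
rewrite /p_free ZC; congr (_ + _); apply: eq_bigr => f /andP[xf _].
rewrite /p_edge ZC; congr (_ * _ / _); rewrite /psum; apply: eq_bigr => M _.
by rewrite gx.
Qed.

Lemma p_edge_ge0 S f : 0 <= p_edge S f.
Proof. by rewrite divr_ge0 ?mulr_ge0 ?ltW ?Z_gt0. Qed.

(** The contraction behind the decay: subtracting [mean (x |: S) g] from the
    decomposition of [mean S g] at [x] kills the term where [x] is free, and the
    other terms carry total mass [1 - p_free S x]. *)
Lemma influence_step x S g c : x \notin S ->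
  (forall f M, x \in val f -> g (f |: M) = g M) ->
  (forall f, x \in val f -> [disjoint val f & S] ->
    `|mean (val f :|: S) g - mean (x |: S) g| <= c) ->
  `|mean S g - mean (x |: S) g| <= (1 - p_free S x) * c.
Proof.
move=> xS gx hc.
have E : \sum_(f : edge adj | (x \in val f) && [disjoint val f & S]) p_edge S f
    = 1 - p_free S x by rewrite -(p_total xS) addrAC subrr add0r.
have -> : mean S g - mean (x |: S) g =
    \sum_(f : edge adj | (x \in val f) && [disjoint val f & S])
      p_edge S f * (mean (val f :|: S) g - mean (x |: S) g).
  under [RHS]eq_bigr do rewrite mulrBr.
  by rewrite (mean_rec xS gx) sumrB -mulr_suml E; ring.
rewrite -E mulr_suml; apply: le_trans (ler_norm_sum _ _ _) _.
apply: ler_sum => f /andP[xf fS]; rewrite normrM ger0_norm ?p_edge_ge0 //.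
by rewrite ler_wpM2l ?p_edge_ge0 ?hc.
Qed.

(** Matchings that leave [y] free already contribute the left-hand side. *)
Lemma Z_add_vertex y S : y \notin S -> b y * Z (y |: S) <= Z S.
Proof.
move=> yS; rewrite {2}/Z (psum_rec _ yS) lerDl; apply: sumr_ge0 => f _.
by rewrite mulr_ge0 ?(ltW (Z_gt0 _)) // ltW.
Qed.

(** Removing [f = xy] from a matching frees [x] and [y] and multiplies the weight
    by [b x * b y / a f]; freeing [x] is all that [p_free] asks for. *)
Lemma p_edge_le x S f : x \in val f -> x \notin S -> [disjoint val f & S] ->
  p_edge S f <= a f / (\prod_(y in val f) b y) * p_free S x.
Proof.
move=> xf xS fS; have [y [Ef xy nxy]] := edge_endsP adj_sym adj_irr xf.
have yS : y \notin x |: S.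
  rewrite !inE negb_or eq_sym nxy /=.
  by have := disjointFr fS; move=> /(_ y) ->; rewrite // Ef !inE eqxx orbT.
have := Z_add_vertex yS; have -> : y |: (x |: S) = val f :|: S.
  by rewrite Ef setUA (setUC [set y]).
have -> : \prod_(y in val f) b y = b x * b y.
  by rewrite Ef big_setU1 ?inE //= big_set1.
move=> h; rewrite /p_edge /p_free mulrA ler_pM2r ?invr_gt0 ?Z_gt0 //.
have -> : a f / (b x * b y) * (b x * Z (x |: S)) = a f * (Z (x |: S) / b y).
  by field; rewrite !gt_eqF.
by rewrite ler_pM2l // ler_pdivlMr // mulrC.
Qed.

(** The bound does not see [S]: it only involves the activities around [x].
    Writing [u] for [p_free S x], the masses of the edges at [x] sum to [1 - u]
    and to at most [D * K * u]. *)
Lemma p_matched_le x S (K : R) (D : nat) : x \notin S ->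
  0 <= K -> (#|neighbours adj x| <= D)%N ->
  (forall f, x \in val f -> a f / (\prod_(y in val f) b y) <= K) ->
  1 - p_free S x <= D%:R * K / (1 + D%:R * K).
Proof.
move=> xS K0 degx hK.
have E := p_total xS.
have u0 : 0 <= p_free S x by rewrite divr_ge0 ?mulr_ge0 ?(ltW (Z_gt0 _)) ?ltW.
have : \sum_(f : edge adj | (x \in val f) && [disjoint val f & S]) p_edge S f
    <= D%:R * K * p_free S x.
  apply: (@le_trans _ _
    (\sum_(f : edge adj | (x \in val f) && [disjoint val f & S]) K * p_free S x)).
    apply: ler_sum => f /andP[xf fS]; apply: le_trans (p_edge_le xf xS fS) _.
    by rewrite ler_wpM2r ?hK.
  rewrite sumr_const -[_ *+ _]mulr_natl -mulrA ler_wpM2r ?(mulr_ge0 K0 u0) // ler_nat.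
  apply: leq_trans degx; apply: leq_trans (card_incident adj_sym adj_irr x).
  by apply: subset_leq_card; apply/subsetP => f; rewrite !inE => /andP[].
have DK : 0 <= D%:R * K by rewrite mulr_ge0.
rewrite ler_pdivlMr ?ltr_pwDl //.
move: E DK u0; set s := \sum_(_ | _) _; set u := p_free S x; set k := _ * K.
by move=> E k0 u0 h; nra.
Qed.

Lemma mean_edge f S g : [disjoint val f & S] ->
  mean S (fun M => (f \in M)%:R * g M)
  = p_edge S f * mean (val f :|: S) (fun M => g (f |: M)).
Proof.
move=> fS; have -> : p_edge S f * mean (val f :|: S) (fun M => g (f |: M))
    = a f * psum (val f :|: S) (fun M => g (f |: M)) / Z S.
  by rewrite /p_edge /mean; field; rewrite !gt_eqF ?Z_gt0.
rewrite -psum_containing // /mean; congr (_ / _).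
rewrite /psum [RHS]big_mkcondr; apply: eq_bigr => M _.
by case: (f \in M); rewrite ?mul1r ?mul0r.
Qed.

Lemma mean1 S : mean S (fun=> 1) = 1.
Proof. by rewrite /mean divff // gt_eqF // Z_gt0. Qed.

Definition activity_covariance (f f' : edge adj) : R :=
  mean set0 (fun M => ((f \in M) && (f' \in M))%:R)
  - mean set0 (fun M => (f \in M)%:R) * mean set0 (fun M => (f' \in M)%:R).

Lemma eq_mean S g h : g =1 h -> mean S g = mean S h.
Proof.
by move=> gh; rewrite /mean /psum; congr (_ / _); apply: eq_bigr => M _; rewrite gh.
Qed.

Lemma activity_covarianceE (f f' : edge adj) : f != f' ->
  activity_covariance f f' = p_edge set0 f *
   (mean (val f) (fun M => (f' \in M)%:R) - mean set0 (fun M => (f' \in M)%:R)).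
Proof.
move=> ff'; have f0 : [disjoint val f & set0 : {set V}].
  by rewrite -setI_eq0 setI0.
rewrite /activity_covariance (eq_mean set0 (h := fun M => (f \in M)%:R * (f' \in M)%:R));
  last by move=> M; rewrite -natrM mulnb.
rewrite (eq_mean set0 (h := fun M => (f \in M)%:R * 1) (g := fun M => (f \in M)%:R));
  last by move=> M; rewrite mulr1.
rewrite !mean_edge // mean1 setU0 mulr1 -mulrBr; congr (_ * (_ - _)).
by apply: eq_mean => M; rewrite !inE eq_sym (negbTE ff').
Qed.

Lemma activity_covariance_le1 f f' : `|activity_covariance f f'| <= 1.
Proof.
have m01 (B : {set edge adj} -> bool) : 0 <= mean set0 (fun M => (B M)%:R) <= 1.
  by apply: mean_itv => M; case: (B M); rewrite ?lexx ?ler01.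
apply: ler_dist01 => //.
have /andP[? ?] := m01 (fun M => f \in M).
have /andP[? ?] := m01 (fun M => f' \in M).
by rewrite mulr_ge0 //= mulr_ile1.
Qed.

Section Decay.
Variables (starts : {set V}) (theta : R) (good : pred V).

(** Walks are listed from their last vertex back to their start, so that
    extending a walk is a [cons]. *)
Definition rev_walk (s : seq V) : bool :=
  if s is x :: p then path adj x p && (last x p \in starts) else true.

Lemma rev_walk_behead x s : rev_walk (x :: s) -> rev_walk s.
Proof. by case: s => //= y s /andP[/andP[_ ->] ->]. Qed.

Hypotheses (theta_ge0 : 0 <= theta) (theta_le1 : theta <= 1).
Hypothesis good_le : forall x S, x \notin S -> good x -> 1 - p_free S x <= theta.
Variables (target : {set V}) (g : {set edge adj} -> R).
Hypothesis g_itv : forall M, 0 <= g M <= 1.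
Hypothesis g_local : forall x f M, x \notin target -> x \in val f ->
  g (f |: M) = g M.
Variables (n m : nat).
Hypothesis target_far : forall x s, rev_walk (x :: s) -> (size s < n)%N ->
  x \notin target.
Hypothesis many_good : forall s, rev_walk s -> uniq s -> size s = n ->
  (m <= count good s)%N.

(** Here [s] is the part of the walk already explored, the most recent vertex
    first, and [x] is the vertex being deleted.  As [S] contains [s], the
    walks produced are self-avoiding; each good vertex met contributes a factor
    [theta], and the vertices of [s] are those whose factor has been spent.  When
    [s] has reached length [n] the exponent is [0] and the trivial bound [1] is
    enough. *)
Lemma influence_decay k s x S : (size s + k)%N = n -> rev_walk (x :: s) ->
  uniq (x :: s) -> {subset s <= S} -> x \notin S ->
  `|mean S g - mean (x |: S) g| <= theta ^+ (m - count good s).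
Proof.
elim: k s x S => [|k IH] s x S sn xs us sS xS.
  have : (m <= count good s)%N.
    by apply: many_good (rev_walk_behead xs) _ _; [case/andP: us | lia].
  rewrite -subn_eq0 => /eqP ->.
  exact: ler_dist01 (mean_itv S g_itv) (mean_itv (x |: S) g_itv).
have xT : x \notin target by apply: target_far xs _; lia.
have p_le1 : 1 - p_free S x <= 1.
  by rewrite gerBl divr_ge0 ?mulr_ge0 ?(ltW (Z_gt0 _)) ?ltW.
apply: le_trans (influence_step (c := theta ^+ (m - count good (x :: s))) xS _ _) _.
- by move=> f M; exact: g_local.
- move=> f xf fS; have [y [Ef xy nxy]] := edge_endsP adj_sym adj_irr xf.
  have yS : y \notin S.
    by apply/negP => yS; have := disjointFl fS yS; rewrite Ef !inE eqxx orbT.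
  have -> : val f :|: S = y |: (x |: S) by rewrite Ef setUA (setUC [set y]).
  rewrite distrC; apply: IH => //.
  - by rewrite -sn addnS.
  - by case/andP: xs => ps ls; rewrite /= adj_sym xy ps.
  - rewrite cons_uniq us andbT inE negb_or eq_sym nxy.
    by apply: contra yS; exact: sS.
  - by move=> z; rewrite !inE => /predU1P[->|/sS ->]; rewrite ?eqxx ?orbT.
  - by rewrite !inE negb_or eq_sym nxy.
rewrite /=; have [gx|gx] := boolP (good x); last first.
  by rewrite add0n ler_piMl ?exprn_ge0.
apply: (@le_trans _ _ (theta * theta ^+ (m - (1 + count good s)))).
  by rewrite ler_wpM2r ?exprn_ge0 ?good_le.
by rewrite -exprS ler_wiXn2l //; lia.
Qed.

End Decay.

Lemma p_edge_le1 S f : [disjoint val f & S] -> p_edge S f <= 1.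
Proof.
move=> fS; have := mean_edge (fun=> 1) fS; rewrite mean1 mulr1 => <-.
suff /andP[] : 0 <= mean S (fun M => (f \in M)%:R * 1) <= 1 by [].
by apply: mean_itv => M; case: (f \in M); rewrite mulr1 ?lexx ?ler01.
Qed.

(** The two endpoints of [f] are deleted one after the other; each deletion
    starts its own family of walks, whence the factor [2]. *)
Lemma activity_covariance_decay (f f' : edge adj) (theta : R) (good : pred V) n m :
  0 <= theta <= 1 ->
  (forall x S, x \notin S -> good x -> 1 - p_free S x <= theta) ->
  (0 < n)%N ->
  (forall x s, rev_walk (val f) (x :: s) -> (size s < n)%N -> x \notin val f') ->
  (forall s, rev_walk (val f) s -> uniq s -> size s = n ->
    (m <= count good s)%N) ->
  `|activity_covariance f f'| <= 2 * theta ^+ m.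
Proof.
move=> /andP[th0 th1] good_le n0 far many.
have [x xf] := edge_nonempty f.
have [y [Ef _ nxy]] := edge_endsP adj_sym adj_irr xf.
have yf : y \in val f by rewrite Ef !inE eqxx orbT.
have ff' : f != f'.
  by apply/eqP => E; have := far x [::] xf n0; rewrite -E xf.
set g := fun M => (f' \in M)%:R : R.
have decay := influence_decay th0 th1 good_le (g := g) _ _ far many.
have g01 M : 0 <= g M <= 1 by rewrite /g; case: (f' \in M); rewrite ?lexx ?ler01.
have g_loc z (h : edge adj) M : z \notin val f' -> z \in val h -> g (h |: M) = g M.
  move=> zf' zh; rewrite /g !inE; case: eqVneq => // E.
  by rewrite E zh in zf'.
have d1 : `|mean set0 g - mean [set x] g| <= theta ^+ m.
  rewrite -(setU0 [set x]) -[m]subn0.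
  by apply: (decay g01 g_loc n [::]) => //; rewrite inE.
have d2 : `|mean [set x] g - mean (val f) g| <= theta ^+ m.
  rewrite Ef setUC -[m]subn0.
  by apply: (decay g01 g_loc n [::]) => //; rewrite inE eq_sym.
rewrite activity_covarianceE // normrM ger0_norm ?p_edge_ge0 //.
apply: (@le_trans _ _ `|mean (val f) g - mean set0 g|).
  by rewrite ler_piMl // p_edge_le1 // -setI_eq0 setI0.
rewrite -(subrK (mean [set x] g) (mean (val f) g)) -addrA mulr2n mulrDl !mul1r.
by apply: le_trans (ler_normD _ _) _; apply: lerD; rewrite distrC.
Qed.

End PartitionSums.

(** * Walks and the sites around them *)

Section Walks.
Variables (V : finType) (adj : rel V) (D : nat).
Hypotheses (adj_sym : symmetric adj) (adj_irr : irreflexive adj).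
Hypothesis deg_le : forall x, (#|neighbours adj x| <= D)%N.

(** An explicit list is used because it makes the number of walks, hence the
    entropy term of the union bound, immediate. *)
Fixpoint rev_walks (starts : {set V}) (n : nat) : seq (seq V) :=
  if n is n'.+1 then
    [seq y :: s | s <- rev_walks starts n',
       y <- enum (if s is x :: _ then neighbours adj x else starts)]
  else [:: [::]].

Lemma mem_rev_walks (starts : {set V}) s : rev_walk adj starts s ->
  s \in rev_walks starts (size s).
Proof.
elim: s => //= y s IH ys; apply/allpairsPdep; exists s, y; split => //.
  by apply: IH; exact: rev_walk_behead ys.
rewrite mem_enum; case: s {IH} ys => //= x s /andP[/andP[yx _] _].
by rewrite inE adj_sym.
Qed.

Lemma mem_rev_walks_size (starts : {set V}) n s :
  s \in rev_walks starts n -> size s = n.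
Proof.
elim: n s => [|n IH] s /=; first by rewrite inE => /eqP ->.
by case/allpairsPdep => s' [y [/IH <- _ ->]].
Qed.

Lemma size_rev_walks (starts : {set V}) n : (#|starts| <= D.+2)%N ->
  (size (rev_walks starts n) <= D.+2 ^ n)%N.
Proof.
move=> st; elim: n => //= n IH; rewrite size_allpairs_dep sumnE big_map.
apply: (@leq_trans (\sum_(s <- rev_walks starts n) D.+2)%N).
  apply: leq_sum => s _; rewrite -cardE; case: s => [//|x _].
  by apply: leq_trans (deg_le x) _; lia.
by rewrite big_const_seq count_predT iter_addn_0 expnS leq_mul2l IH orbT.
Qed.

(** The sites whose weights enter the bound on the probability that [x] is
    matched. *)
Definition star (x : V) : {set V + edge adj} :=
  inl @: (x |: neighbours adj x) :|: inr @: [set f : edge adj | x \in val f].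

Lemma mem_star_vertex x y : (inl y \in star x) = (y == x) || adj x y.
Proof.
rewrite inE mem_imset; last by move=> ? ? [].
rewrite !inE (_ : inl y \in inr @: _ = false) ?orbF //.
by apply/negP => /imsetP[].
Qed.

Lemma mem_star_edge x (f : edge adj) : (inr f \in star x) = (x \in val f).
Proof.
rewrite inE [in X in _ || X]mem_imset; last by move=> ? ? [].
rewrite !inE (_ : inr f \in inl @: _ = false) //.
by apply/negP => /imsetP[].
Qed.

Lemma card_star x : (#|star x| <= D.*2.+1)%N.
Proof.
apply: leq_trans (leq_card_setU _ _) _.
rewrite -addnn -addSn; apply: leq_add; apply: leq_trans (leq_imset_card _ _) _.
  by apply: leq_trans (leq_card_setU _ _) _; rewrite cards1 add1n ltnS.
exact: leq_trans (card_incident adj_sym adj_irr x) _.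
Qed.

(** A vertex lies in its own star and in those of its neighbours, an edge in the
    stars of its two endpoints; [D + 2] covers both cases. *)
Lemma card_star_inv z : (#|[set x | z \in star x]| <= D.+2)%N.
Proof.
case: z => [y|f].
  apply: (@leq_trans #|y |: neighbours adj y|); last first.
    by apply: leq_trans (leq_card_setU _ _) _; rewrite cards1 add1n ltnS ltnW // ltnS.
  apply: subset_leq_card; apply/subsetP => x.
  by rewrite in_set mem_star_vertex !inE adj_sym eq_sym.
apply: (@leq_trans #|val f|); last by rewrite (card_edge adj_sym adj_irr).
by apply: subset_leq_card; apply/subsetP => x; rewrite in_set mem_star_edge.
Qed.

Definition stars (s : seq V) : {set V + edge adj} := \bigcup_(x in s) star x.

Lemma card_stars s : (#|stars s| <= size s * D.*2.+1)%N.
Proof.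
apply: (@leq_trans (\sum_(x in s) #|star x|)%N).
  apply: (big_ind2 (fun (A : {set _}) c => #|A| <= c)%N) => //.
  - by rewrite cards0.
  - move=> A c B c' Ac Bc'; apply: leq_trans (leq_card_setU _ _) _.
    exact: leq_add.
apply: (@leq_trans (\sum_(x in s) D.*2.+1)%N).
  by apply: leq_sum => x _; exact: card_star.
by rewrite sum_nat_const leq_mul2r card_size orbT.
Qed.

Definition clean (bad : {set V + edge adj}) (x : V) : bool :=
  [disjoint star x & bad].

Lemma cleanP bad x z : clean bad x -> z \in star x -> z \notin bad.
Proof. by move=> cx zx; rewrite (disjointFr cx). Qed.

(** Double counting of the pairs (vertex of [s], bad site in its star). *)
Lemma count_clean (bad : {set V + edge adj}) s k : uniq s ->
  (#|bad :&: stars s| <= k)%N ->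
  (size s - D.+2 * k <= count (clean bad) s)%N.
Proof.
move=> us bk; set good := clean bad.
have : (count (predC good) s <= D.+2 * k)%N.
  apply: (@leq_trans (\sum_(x in s) #|star x :&: bad|)%N).
    rewrite -sum1_count big_mkcond big_uniq //=; apply: leq_sum => x _.
    by case: ifP => // /=; rewrite /good /clean -setI_eq0 -card_gt0.
  apply: (@leq_trans (\sum_(z in bad :&: stars s) #|[set x | z \in star x]|)%N).
    rewrite (eq_bigr (fun x => \sum_(z in bad :&: stars s) (z \in star x : nat))%N).
      rewrite exchange_big /=; apply: leq_sum => z _.
      rewrite -sum1_card [leqRHS]big_mkcond [leqLHS]big_mkcond /=.
      apply: leq_sum => x _; rewrite in_set.
      by case: (x \in s); case: (z \in star x).
    move=> x xs; rewrite -sum1_card big_mkcond [RHS]big_mkcond /=.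
    apply: eq_bigr => z _; rewrite !in_setI; have [zx|_] := boolP (z \in star x).
      have -> : z \in stars s by apply/bigcupP; exists x.
      by rewrite andbT.
    by rewrite if_same.
  apply: leq_trans (_ : \sum_(z in bad :&: stars s) D.+2 <= _)%N.
    by apply: leq_sum => z _; exact: card_star_inv.
  by rewrite sum_nat_const mulnC leq_mul2l bk orbT.
by rewrite -(count_predC good s); lia.
Qed.

End Walks.

Definition bad_sites (R : realDomainType) (V : finType) (adj : rel V)
    (w : edge adj -> R) (nu : V -> R) (K : R) : {set V + edge adj} :=
  [set z : V + edge adj |
     match z with inl y => nu y < - K | inr f => K < w f end].

From mathcomp Require Import all_classical all_reals all_analysis.
From mathcomp Require Import measurable_realfun.
Import numFieldNormedType.Exports.
Local Open Scope classical_set_scope.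

(** * The covariance bound for fixed weights *)

Section Deterministic.
Variables (R : realType) (V : finType) (adj : rel V) (D : nat).
Hypotheses (adj_sym : symmetric adj) (adj_irr : irreflexive adj).
Hypothesis deg_le : forall x, (#|neighbours adj x| <= D)%N.
Variables (w : edge adj -> R) (nu : V -> R).
Let a f := expR (w f).
Let b x := expR (nu x).

Lemma boltzmannE M : boltzmann w nu M = weight a b finset.set0 M.
Proof.
rewrite /boltzmann /weight expRD !expR_sum; congr (_ * _).
by apply: eq_bigl => x; rewrite finset.in_set0 andbT.
Qed.

Lemma avoids0 (M : {set edge adj}) : avoids finset.set0 M.
Proof. by apply/forall_inP => f _; rewrite -setI_eq0 finset.setI0. Qed.

Lemma gibbs_meanE g : gibbs_mean w nu g = mean a b finset.set0 g.
Proof.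
rewrite /gibbs_mean /mean /Z /psum mulr_suml.
have -> : \sum_(M : {set edge adj} | matching M && avoids finset.set0 M)
    1 * weight a b finset.set0 M = partition_function w nu.
  by apply: eq_big => [M|M _]; rewrite ?avoids0 ?andbT // mul1r boltzmannE.
apply: eq_big => [M|M _]; first by rewrite avoids0 andbT.
by rewrite /gibbs boltzmannE mulrA.
Qed.

Lemma edge_covarianceE e e' : edge_covariance w nu e e' = activity_covariance a b e e'.
Proof. by rewrite /edge_covariance !gibbs_meanE. Qed.

(** The bound of [p_matched_le] when the weights around a vertex give the ratio
    of activities at most [expR (3 * K)], one factor [expR K] for the edge and one
    for each endpoint. *)
Definition matched_bound (K : R) : R :=
  D%:R * expR (3 * K) / (1 + D%:R * expR (3 * K)).

Lemma matched_bound_itv K : 0 <= matched_bound K < 1.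
Proof.
have h : 0 <= D%:R * expR (3 * K) by rewrite mulr_ge0 ?expR_ge0.
by rewrite divr_ge0 ?addr_ge0 //= ltr_pdivrMr ?ltr_pwDl // mul1r ltrDr.
Qed.

Lemma clean_matched_le K x (S : {set V}) : x \notin S ->
  clean (bad_sites w nu K) x ->
  1 - p_free a b S x <= matched_bound K.
Proof.
move=> xS gx.
have good := cleanP gx.
apply: p_matched_le => // [f|y|f xf]; rewrite ?expR_gt0 ?expR_ge0 //.
have [y [Ef xy nxy]] := edge_endsP adj_sym adj_irr xf.
rewrite -expR_sum -expRB ler_expR.
have -> : \sum_(z in val f) nu z = nu x + nu y.
  by rewrite Ef big_setU1 ?finset.inE //= big_set1.
have := good (inr f) _; rewrite mem_star_edge => /(_ xf).
have := good (inl x) _; rewrite mem_star_vertex eqxx => /(_ isT).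
have := good (inl y) _; rewrite mem_star_vertex xy orbT => /(_ isT).
by rewrite !finset.in_set -!leNgt; lra.
Qed.

Lemma walk_far (e e' : edge adj) n x s : ((n%:R)%:E <= edge_dist R e e')%E ->
  rev_walk adj (val e) (x :: s) -> (size s < n)%N -> x \notin val e'.
Proof.
move=> ne /andP[ps ls] sn; apply/negP => xe'.
have : (edge_dist R e e' <= ((size s)%:R)%:E)%E.
  apply: ge_ereal_inf; exists (vertex_dist R adj (last x s) x).
    by exists (last x s, x).
  apply: ge_ereal_inf; exists ((size s)%:R)%:E => //.
  exists (rev (belast x s)); last by rewrite size_rev size_belast.
  split; first by rewrite rev_path (eq_path (e' := adj)).
  by case: s {ps ls sn} => //= y s; rewrite rev_cons last_rcons.
by move=> /(le_trans ne); rewrite lee_fin ler_nat leqNgt sn.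
Qed.

Lemma edge_covariance_le1 e e' : `|edge_covariance w nu e e'| <= 1.
Proof. by rewrite edge_covarianceE activity_covariance_le1 // => ?; exact: expR_gt0. Qed.

(** At least half of the vertices of a self-avoiding walk of [2 (D + 2) k] vertices
    are clean when their stars contain at most [k] bad sites, and half is at
    least [k]. *)
Lemma edge_covariance_decay K (e e' : edge adj) k :
  ((D.+2 * 2 * k)%:R%:E <= edge_dist R e e')%E -> (0 < k)%N ->
  (forall s, s \in rev_walks adj (val e) (D.+2 * 2 * k) ->
    (#|bad_sites w nu K :&: stars adj s| <= k)%N) ->
  `|edge_covariance w nu e e'| <= 2 * matched_bound K ^+ k.
Proof.
move=> dist k0 few; have /andP[th0 th1] := matched_bound_itv K.
rewrite edge_covarianceE.
apply: (@activity_covariance_decay _ _ _ adj_sym adj_irr a b _ _ _ _ _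
  (clean (bad_sites w nu K)) (D.+2 * 2 * k)).
- by move=> ?; exact: expR_gt0.
- by move=> ?; exact: expR_gt0.
- by rewrite th0 ltW.
- by move=> x S; exact: clean_matched_le.
- by rewrite !muln_gt0.
- by move=> x s; exact: walk_far.
move=> s ws us sn.
have := mem_rev_walks adj_sym ws; rewrite sn => /few bk.
have := count_clean adj_sym adj_irr deg_le us bk; rewrite sn.
by apply: leq_trans; nia.
Qed.

End Deterministic.

(** * Tails of the weight distributions *)

Section Tails.
Variables (R : realType) (mu : probability R R) (eps : R).
Hypothesis eps_gt0 : 0 < eps.

Lemma vanishing_measure (F : nat -> set R) : (forall n, measurable (F n)) ->
  (forall m n, (m <= n)%N -> F n `<=` F m) -> \bigcap_n F n = set0 ->
  exists N, (mu (F N) <= eps%:E)%E.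
Proof.
move=> mF decF F0.
have : mu \o F @ \oo --> mu (\bigcap_n F n).
  apply: nonincreasing_cvg_mu => //.
  - by rewrite (le_lt_trans (probability_le1 _ _)) ?ltry.
  - by rewrite F0.
  - by move=> m n mn; apply/subsetPset; exact: decF.
rewrite F0 measure0 => /fine_cvgP[_ cvg].
have /cvgrPdist_le/(_ _ eps_gt0)[N _ h] := cvg.
exists N; have := h N (leqnn _); rewrite sub0r normrN /= => hN.
rewrite -(@fineK _ (mu (F N))) ?fin_num_measure ?lee_fin //.
by apply: le_trans hN; exact: ler_norm.
Qed.

Lemma upper_tail : exists K0 : nat, forall K : R, K0%:R <= K ->
  (mu `]K, +oo[%classic <= eps%:E)%E.
Proof.
have [||| N hN] := @vanishing_measure (fun n => `]n%:R, +oo[%classic).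
- by move=> n; exact: measurable_itv.
- move=> m n mn x /=; rewrite !in_itv /= !andbT.
  by apply: le_lt_trans; rewrite ler_nat.
- rewrite -subset0 => x /(_ (Num.bound `|x|) I) /=; rewrite in_itv /= andbT.
  by rewrite ltNge (le_trans (ler_norm x)) // ltW // archi_boundP.
exists N => K NK; apply: le_trans hN.
apply: le_measure; rewrite ?inE; try exact: measurable_itv.
by move=> x /=; rewrite !in_itv /= !andbT; exact: le_lt_trans.
Qed.

Lemma lower_tail : exists K0 : nat, forall K : R, K0%:R <= K ->
  (mu `]-oo, (- K)%R[%classic <= eps%:E)%E.
Proof.
have [||| N hN] := @vanishing_measure (fun n => `]-oo, (- n%:R)%R[%classic).
- by move=> n; exact: measurable_itv.
- move=> m n mn x /=; rewrite !in_itv /=.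
  by move=> /lt_le_trans; apply; rewrite lerN2 ler_nat.
- rewrite -subset0 => x /(_ (Num.bound `|x|) I) /=; rewrite in_itv /=.
  rewrite ltNge lerNl (le_trans (ler_norm _)) // normrN ltW //.
  exact: archi_boundP.
exists N => K NK; apply: le_trans hN.
apply: le_measure; rewrite ?inE; try exact: measurable_itv.
by move=> x /=; rewrite !in_itv /=; move=> /lt_le_trans; apply; rewrite lerN2.
Qed.

End Tails.

(** * Probability of many bad sites along a walk *)

Section Events.
Context (d : measure_display) (T : measurableType d) (R : realType)
  (P : probability T R).
Variables (V : finType) (adj : rel V) (law_edge law_vertex : probability R R).
Variables (w : edge adj -> {RV P >-> R}) (nu : V -> {RV P >-> R}).
Hypotheses (w_iid : iid_with_law law_edge w)
  (nu_iid : iid_with_law law_vertex nu) (w_nu : independent_families w nu).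
Variables (K eps : R).
Hypotheses (eps_ge0 : 0 <= eps)
  (edge_tail : (law_edge `]K, +oo[%classic <= eps%:E)%E)
  (vertex_tail : (law_vertex `]-oo, (- K)%R[%classic <= eps%:E)%E).

Definition bad_at (t : T) : {set V + edge adj} :=
  bad_sites (fun f => w f t) (fun x => nu x t) K.

Lemma measurable_sigma_family (I : Type) (X : I -> {RV P >-> R}) A :
  sigma_family X A -> measurable A.
Proof.
apply: smallest_sub; first exact: sigma_algebra_measurable.
move=> B [i _] [C mC <-]; rewrite setTI.
by rewrite -[X in measurable X]setTI; exact: measurable_funP.
Qed.

Lemma sigma_family_bigcap (I : finType) (X : I -> {RV P >-> R}) (J : {set I})
    (B : set R) : measurable B ->
  sigma_family X (\bigcap_(i in [set` J]) (X i @^-1` B)).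
Proof.
move=> mB.
have := @fin_bigcap_measurable _ (g_sigma_algebraType
  (\bigcup_(i in [set: I]) preimage_set_system [set: T] (X i) measurable)) I
  [set` J] (fun i => X i @^-1` B).
apply; first exact: finite_finset.
move=> i _; apply: sub_sigma_algebra; exists i => //.
by exists B => //; rewrite setTI.
Qed.

Lemma prob_bigcap_le (I : finType) (X : I -> {RV P >-> R}) law (J : {set I})
    (B : set R) : iid_with_law law X -> measurable B ->
  (law B <= eps%:E)%E ->
  (P (\bigcap_(i in [set` J]) (X i @^-1` B)) <= (eps ^+ #|J|)%:E)%E.
Proof.
move=> [indep same] mB lB; rewrite (indep J (fun=> B)) //.
have -> : (\prod_(i in J) P (X i @^-1` B) = \prod_(i in J) law B)%E.
  by apply: eq_bigr => i _; rewrite -(same i B mB).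
rewrite -(@fineK _ (law B)) ?fin_num_measure //.
rewrite prodEFin prodr_const lee_fin lerXn2r ?nnegrE ?fine_ge0 //.
by rewrite -lee_fin fineK ?fin_num_measure.
Qed.

Definition all_bad (J : {set V + edge adj}) : set T :=
  [set t | {subset J <= bad_at t}].

(** Separates the edge weights from the vertex weights, which are only
    independent as two families. *)
Lemma all_badE J : all_bad J =
  (\bigcap_(f in [set` inr @^-1: J]) (w f @^-1` `]K, +oo[%classic)) `&`
  (\bigcap_(x in [set` inl @^-1: J]) (nu x @^-1` `]-oo, (- K)%R[%classic)).
Proof.
apply/seteqP; split => [t Jt|t [We Wv] z zJ]; last first.
  rewrite finset.in_set; case: z zJ => [x|f] zJ.
    by have := Wv x; rewrite /= finset.in_set in_itv; apply.
  by have := We f; rewrite /= finset.in_set in_itv /= andbT; apply.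
split => z /=; rewrite finset.in_set => /Jt; rewrite finset.in_set in_itv //=.
by rewrite andbT.
Qed.

Let m_upper : measurable (`]K, +oo[%classic : set R) := measurable_itv _.
Let m_lower : measurable (`]-oo, (- K)%R[%classic : set R) := measurable_itv _.

Lemma measurable_all_bad J : measurable (all_bad J).
Proof.
rewrite all_badE; apply: measurableI.
  exact: measurable_sigma_family (@sigma_family_bigcap _ w _ _ m_upper).
exact: measurable_sigma_family (@sigma_family_bigcap _ nu _ _ m_lower).
Qed.

Lemma prob_all_bad J : (P (all_bad J) <= (eps ^+ #|J|)%:E)%E.
Proof.
rewrite all_badE w_nu; try exact: sigma_family_bigcap.
rewrite card_sum_parts addnC exprD EFinM; apply: lee_pmul => //.
  exact: prob_bigcap_le w_iid m_upper edge_tail.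
exact: prob_bigcap_le nu_iid m_lower vertex_tail.
Qed.

Lemma prob_bigsetU_le (I : Type) (s : seq I) (p : pred I) (F : I -> set T)
    (c : R) : 0 <= c ->
  (forall i, p i -> measurable (F i)) -> (forall i, p i -> (P (F i) <= c%:E)%E) ->
  measurable (\big[setU/set0]_(i <- s | p i) F i) /\
  (P (\big[setU/set0]_(i <- s | p i) F i) <= ((count p s)%:R * c)%:E)%E.
Proof.
move=> c0 mF Fc; elim: s => [|i s [mU IH]].
  by rewrite big_nil measure0 mul0r; split.
rewrite big_cons /=; case: ifP => pi; rewrite ?add0n //; split.
  by apply: measurableU => //; exact: mF.
apply: le_trans (measureU2 _ (mF i pi) mU) _.
by rewrite natrD mulrDl mul1r EFinD leeD // Fc.
Qed.

(** The event is a union over explicit sets of [k] bad sites, which makes it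
    measurable and ready for a union bound. *)
Definition bad_event (starts : {set V}) (n k : nat) : set T :=
  \big[setU/set0]_(s <- rev_walks adj starts n)
    \big[setU/set0]_(J : {set V + edge adj} |
        (J \subset stars adj s) && (#|J| == k)) all_bad J.

Lemma bad_eventP starts n k t : ~ bad_event starts n k t ->
  forall s, s \in rev_walks adj starts n ->
    (#|bad_at t :&: stars adj s| <= k)%N.
Proof.
move=> nB s sW; rewrite leqNgt; apply/negP => lt; apply: nB.
have [J JA cJ] := exists_subset_card (ltnW lt).
rewrite /bad_event -bigcup_seq; exists s => //=.
rewrite -big_filter -bigcup_seq; exists J => /=.
  by rewrite mem_filter cJ andbT mem_index_enum andbT (fintype.subset_trans JA) ?finset.subsetIr.
by move=> z zJ; have := fintype.subsetP JA z zJ; rewrite finset.in_setI => /andP[].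
Qed.

(** Union bound: [(D + 2) ^ n] walks, at most [2 ^ (n * (2 D + 1))] sets of sites
    around each, and [eps ^ k] for each set. *)
Lemma prob_bad_event (D : nat) (starts : {set V}) n k :
  symmetric adj -> irreflexive adj ->
  (forall x, #|neighbours adj x| <= D)%N -> (#|starts| <= D.+2)%N ->
  measurable (bad_event starts n k) /\
  (P (bad_event starts n k) <=
    ((D.+2 ^ n)%:R * ((2 ^ (n * D.*2.+1))%:R * eps ^+ k))%:E)%E.
Proof.
move=> adj_sym adj_irr deg_le starts_le.
set c := (2 ^ (n * D.*2.+1))%:R * eps ^+ k.
have c0 : 0 <= c by rewrite mulr_ge0 ?exprn_ge0.
have inner s : s \in rev_walks adj starts n ->
  measurable (\big[setU/set0]_(J : {set V + edge adj} |
        (J \subset stars adj s) && (#|J| == k)) all_bad J) /\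
  (P (\big[setU/set0]_(J : {set V + edge adj} |
        (J \subset stars adj s) && (#|J| == k)) all_bad J) <= c%:E)%E.
  move=> sW.
  pose p (J : {set V + edge adj}) := (J \subset stars adj s) && (#|J| == k).
  have pJ J : p J -> (P (all_bad J) <= (eps ^+ k)%:E)%E.
    by move=> /andP[_ /eqP <-]; exact: prob_all_bad.
  have [mU PU] := @prob_bigsetU_le _ (index_enum _) p all_bad _
    (exprn_ge0 k eps_ge0) (fun J _ => measurable_all_bad J) pJ.
  split=> //; apply: le_trans PU _; rewrite lee_fin ler_wpM2r ?exprn_ge0 // ler_nat.
  apply: (@leq_trans (2 ^ #|stars adj s|)).
    by apply: count_subsets => J /andP[].
  rewrite leq_exp2l //; apply: leq_trans (card_stars adj_sym adj_irr deg_le s) _.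
  by rewrite (mem_rev_walks_size sW).
have [mB PB] := @prob_bigsetU_le _ (rev_walks adj starts n)
  (mem (rev_walks adj starts n)) _ _ c0
  (fun s sW => (inner s sW).1) (fun s sW => (inner s sW).2).
rewrite /bad_event big_seq; split => //; apply: le_trans PB _.
rewrite lee_fin ler_wpM2r // ler_nat.
apply: leq_trans (count_size _ _) _; exact: size_rev_walks.
Qed.

End Events.

(** * From the bad event to the expectation *)

Section Measurability.
Context (d : measure_display) (T : measurableType d) (R : realType)
  (P : probability T R).
Variables (V : finType) (adj : rel V).
Variables (w : edge adj -> {RV P >-> R}) (nu : V -> {RV P >-> R}).

Lemma measurable_sum_cond (I : Type) (s : seq I) (p : pred I) (h : I -> T -> R) :
  (forall i, measurable_fun setT (h i)) ->
  measurable_fun setT (fun t => \sum_(i <- s | p i) h i t).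
Proof.
by move=> mh; under eq_fun do rewrite -big_filter; exact: measurable_sum.
Qed.

Let energy (M : {set edge adj}) t :=
  \sum_(e in M) w e t + \sum_(x | unmatched M x) nu x t.

Let measurable_energy M : measurable_fun setT (energy M).
Proof. by apply: measurable_funD; apply: measurable_sum_cond. Qed.

Lemma measurable_gibbs_mean (g : {set edge adj} -> R) :
  measurable_fun setT
    (fun t => gibbs_mean (fun f => w f t) (fun x => nu x t) g).
Proof.
apply: measurable_sum_cond => M; apply: measurable_funM => //.
(* Division by the partition function becomes subtraction of its logarithm. *)
pose logZ t := ln (partition_function (fun f => w f t) (fun x => nu x t)).
have -> : (fun t => gibbs (fun f => w f t) (fun x => nu x t) M) =
    (fun t => expR (energy M t - logZ t)).
  apply/funext => t; rewrite expRD expRN lnK //.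
  rewrite posrE /partition_function (bigD1 finset.set0) /=; last first.
    by apply/forall_inP => f; rewrite finset.in_set0.
  by rewrite ltr_pwDl ?expR_gt0 // sumr_ge0 // => ? _; exact: expR_ge0.
apply: measurableT_comp => //; apply: measurable_funB => //.
apply: measurableT_comp => //; apply: measurable_sum_cond => M'.
by apply: measurableT_comp => //; exact: measurable_energy.
Qed.

Lemma measurable_edge_covariance (e e' : edge adj) :
  measurable_fun setT
    (fun t => edge_covariance (fun f => w f t) (fun x => nu x t) e e').
Proof.
apply: measurable_funB; first exact: measurable_gibbs_mean.
by apply: measurable_funM; exact: measurable_gibbs_mean.
Qed.

Lemma expectation_le_outside (f : T -> R) (B : set T) (c : R) :
  measurable_fun setT f -> measurable B -> 0 <= c ->
  (forall t, 0 <= f t <= 1) -> (forall t, ~ B t -> f t <= c) ->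
  ('E_P[f] <= c%:E + P B)%E.
Proof.
move=> mf mB c0 f01 fB; rewrite unlock.
have mI : measurable_fun setT (fun t => (\1_B t)%:E : \bar R).
  by apply/measurable_EFinP; exact: measurable_indic.
apply: (@le_trans _ _ (\int[P]_t (c%:E + (\1_B t)%:E))%E).
  apply: ge0_le_integral => //.
  - by move=> t _; rewrite lee_fin; have /andP[] := f01 t.
  - exact/measurable_EFinP.
  - exact: emeasurable_funD.
  move=> t _; rewrite -EFinD lee_fin indicE.
  have [tB|tB] := boolP (t \in B).
    by have /andP[_ ?] := f01 t; rewrite -[f t]add0r lerD.
  by rewrite addr0 fB // => Bt; rewrite mem_set in tB.
rewrite ge0_integralD //.
rewrite integral_indic // setIT.
by rewrite integral_cst //= probability_setT mule1.
Qed.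

End Measurability.

Lemma edge_dist_ge0 (R : realType) (V : finType) (adj : rel V)
  (e e' : edge adj) : (0 <= edge_dist R e e')%E.
Proof.
apply/ereal_infP => _ [[x y] _ <-] /=; apply/ereal_infP => _ [p _ <-].
by rewrite lee_fin.
Qed.

(** * The rate of decay *)

Section Rate.
Variables (R : realType) (D : nat) (law_edge law_vertex : probability R R).

(** The order of choices matters: [eps] is fixed by the entropy [q] of walks and
    sets of sites per unit of [k], so that the bad event has probability at most
    [2 ^- k]; then [K] by the tails of the two laws; and [K] determines the
    contraction factor [theta]. *)
Lemma decay_rate : exists2 rho : R, 0 < rho < 1 &
  forall (V : finType) (adj : rel V), symmetric adj -> irreflexive adj ->
    (forall x, #|neighbours adj x| <= D)%N ->
  forall (d : measure_display) (T : measurableType d) (P : probability T R)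
    (w : edge adj -> {RV P >-> R}) (nu : V -> {RV P >-> R}),
    iid_with_law law_edge w -> iid_with_law law_vertex nu ->
    independent_families w nu ->
  forall (e e' : edge adj) (k : nat),
    ((D.+2 * 2 * k)%:R%:E <= edge_dist R e e')%E ->
    ('E_P[fun t => `| edge_covariance (fun f => w f t) (fun x => nu x t) e e' |%R]
    <= (3 * rho ^+ k)%:E)%E.
Proof.
pose n := (D.+2 * 2)%N; pose q := (D.+2 ^ n * 2 ^ (n * D.*2.+1))%N.
have q0 : 0 < q%:R :> R by rewrite ltr0n muln_gt0 !expn_gt0.
pose eps : R := (q%:R * 2)^-1.
have eps0 : 0 < eps by rewrite invr_gt0 mulr_gt0.
have [K1 hK1] := upper_tail law_edge eps0.
have [K2 hK2] := lower_tail law_vertex eps0.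
pose K : R := (maxn K1 K2)%:R.
have {}hK1 := hK1 K _; have {}hK2 := hK2 K _.
have {hK1} edge_tail := hK1 (ltac:(by rewrite ler_nat leq_maxl)).
have {hK2} vertex_tail := hK2 (ltac:(by rewrite ler_nat leq_maxr)).
have /andP[th0 th1] := matched_bound_itv D K.
set theta := matched_bound D K in th0 th1.
pose rho := Num.max theta 2^-1.
have rho_th : theta <= rho by rewrite le_max lexx.
have rho_half : 2^-1 <= rho by rewrite le_max lexx orbT.
have rho0 : 0 < rho by apply: lt_le_trans rho_half; lra.
exists rho; first by rewrite rho0 /= gt_max th1 /=; lra.
move=> V adj adj_sym adj_irr deg_le d T P w nu w_iid nu_iid w_nu e e' k dist.
have starts_le : (#|val e| <= D.+2)%N by rewrite (card_edge adj_sym adj_irr).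
have [mB PB] := prob_bad_event w_iid nu_iid w_nu (ltW eps0) edge_tail vertex_tail
  (D.+2 * 2 * k) k adj_sym adj_irr deg_le starts_le.
apply: le_trans (@expectation_le_outside _ _ _ P _ _ (2 * theta ^+ k)
    _ mB _ _ _) _.
- by apply: measurableT_comp => //; exact: measurable_edge_covariance.
- by rewrite mulr_ge0 ?exprn_ge0.
- by move=> t; rewrite normr_ge0 edge_covariance_le1.
- move=> t nB; case: (posnP k) => [->|k0].
    by rewrite expr0 mulr1 (le_trans (edge_covariance_le1 _ _ _ _)) ?ler1n.
  by apply: edge_covariance_decay => //; exact: bad_eventP.
have -> : 3 * rho ^+ k = 2 * rho ^+ k + rho ^+ k by ring.
rewrite EFinD; apply: leeD.
  by rewrite lee_fin ler_pM2l // lerXn2r ?nnegrE ?(ltW rho0).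
apply: le_trans PB _; rewrite lee_fin mulrA -natrM.
rewrite -/n.
(* Entropy and tail combine into (q * eps) ^ k = 2 ^- k. *)
have -> : (D.+2 ^ (n * k) * 2 ^ (n * k * D.*2.+1))%N = (q ^ k)%N.
  by rewrite /q expnMn -!expnM; congr (_ * _ ^ _)%N; rewrite mulnAC.
rewrite natrX -exprMn lerXn2r ?nnegrE ?(ltW rho0) //.
  by rewrite mulr_ge0 // ltW.
apply: le_trans rho_half; rewrite /eps invfM mulrA divff ?mul1r //.
by rewrite gt_eqF.
Qed.

End Rate.

(** Passing from the [k] blocks of [n] vertices that fit in a distance [x] to
    the distance itself costs at most one block, that is, a factor [rho^-1]. *)
Lemma power_le_exp (R : realType) (rho x : R) (n k : nat) : 0 < rho < 1 ->
  (0 < n)%N -> x <= (n * k.+1)%:R ->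
  rho ^+ k <= rho^-1 * expR (- (- ln rho / n%:R * x)).
Proof.
move=> /andP[rho0 rho1] n0 xk; rewrite ler_pdivlMl // -exprS.
rewrite -[X in X ^+ _]lnK // -expRM_natl ler_expR.
have n0' : 0 < n%:R :> R by rewrite ltr0n.
rewrite -!mulNr opprK mulrAC ler_pdivlMr // mulrAC -natrM.
have l0 : ln rho <= 0 by rewrite ln_le0 // ltW.
by rewrite [leRHS]mulrC ler_wnM2r // mulnC.
Qed.

(** Settles edges of different components: their distance is infinite, so every
    [k] is admissible. *)
Lemma nneg_le_powers0 (R : realType) (rho C : R) (x : \bar R) : 0 < rho < 1 ->
  (forall k, x <= (C * rho ^+ k)%:E)%E -> (x <= 0)%E.
Proof.
move=> /andP[rho0 rho1] h.
have cvg : C * rho ^+ k @[k --> \oo] --> (C * 0 : R).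
  by apply: cvgMr; apply: cvg_expr; rewrite ger0_norm // ltW.
apply/lee_addgt0Pr => e e0; rewrite add0e.
have /cvgrPdist_le/(_ _ e0)[N _ hN] := cvg.
apply: le_trans (h N) _; rewrite lee_fin.
have := hN N (leqnn _); rewrite mulr0 sub0r normrN; apply: le_trans.
exact: ler_norm.
Qed.

Local Open Scope ereal_scope.

Theorem proposition1p8 (R : realType) (D : nat)
    (law_edge law_vertex : probability R R) :
  exists c C : R, [/\ (0 < c)%R, (0 < C)%R &
  forall (V : finType) (adj : rel V), symmetric adj -> irreflexive adj ->
    max_degree adj = D ->
  forall (d : measure_display) (T : measurableType d) (P : probability T R)
    (w : edge adj -> {RV P >-> R}) (nu : V -> {RV P >-> R}),
    iid_with_law law_edge w -> iid_with_law law_vertex nu ->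
    independent_families w nu ->
  forall e e' : edge adj,
    'E_P[fun t => `| edge_covariance (fun f => w f t) (fun x => nu x t) e e' |%R]
    <= C%:E * expeR (- (c%:E * edge_dist R e e'))].
Proof.
have [rho rho01 bound] := decay_rate D law_edge law_vertex.
have /andP[rho0 rho1] := rho01.
pose n := (D.+2 * 2)%N.
have n0 : (0 < n%:R :> R)%R by rewrite ltr0n.
have c0 : (0 < - ln rho / n%:R)%R by rewrite divr_gt0 // oppr_gt0 ln_lt0 // rho0.
(* One factor rho is gained every n steps of distance. *)
exists (- ln rho / n%:R)%R, (3 * rho^-1)%R; split => //.
  by rewrite mulr_gt0 // invr_gt0.
move=> V adj adj_sym adj_irr maxD d T P w nu w_iid nu_iid w_nu e e'.
have deg_le x : (#|neighbours adj x| <= D)%N.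
  by rewrite -maxD /max_degree; exact: leq_bigmax.
have {bound} := bound V adj adj_sym adj_irr deg_le d T P w nu w_iid nu_iid w_nu e e'.
move: (edge_dist_ge0 R e e'); case: (edge_dist R e e') => [x|_ bound|//].
- rewrite lee_fin => x0 bound.
  have xn0 : (0 <= x / n%:R)%R by rewrite divr_ge0 // ltW.
  have /andP[kx xk] := truncn_itv xn0.
  set k := Num.truncn _ in kx xk.
  have /bound h : ((n * k)%:R%:E <= x%:E :> \bar R)%E.
    by rewrite lee_fin natrM mulrC -ler_pdivlMr.
  apply: le_trans h _; rewrite -EFinM lee_fin -mulrA.
  rewrite ler_pM2l //; apply: power_le_exp => //.
  by rewrite natrM mulrC -ler_pdivrMr // ltW.
rewrite gt0_muley ?lte_fin //= mule0; apply: (nneg_le_powers0 rho01) => k.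
by apply: bound; rewrite leey.
Qed.
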